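(* Suppose Assumptions 1–4 hold, and suppose that there is $\theta_0=(\beta_0,\gamma_0)\in\mathrm{int}(\Theta^c)$ such that, almost surely, $\mu(X)=X'\beta_0$ and $\sigma(X)^2=s(X'\gamma_0)^2$. Then $\theta_0$ is the unique minimizer of $Q(\theta)$ over $\Theta$.
   Context: Let $Y$ be a scalar random variable and $X$ a random $k\times1$ vector whose first component equals $1$; let $\mathcal{X}$ denote the support of $X$. Write $\mu(X)=E[Y\mid X]$ and $\sigma(X)^2=E[(Y-\mu(X))^2\mid X]$. Let $s$ be a positive scale function, write $s_j(t)=\partial^j s(t)/\partial t^j$ for $j=1,2,3$, and set $\Theta_\gamma=\{\gamma\in\mathbb{R}^k:\Pr[s(X'\gamma)>0]=1\}$ and $\Theta=\mathbb{R}^k\times\Theta_\gamma$. For $\theta=(\beta,\gamma)\in\Theta$ put $e(Y,X,\theta)=(Y-X'\beta)/s(X'\gamma)$ and $Q(\theta)=E\big[\tfrac12\{e(Y,X,\theta)^2+1\}s(X'\gamma)\big]$. Let $\Theta^c=\{\theta\in\Theta:\|\theta\|\le C_\theta,\ \inf_{x\in\mathcal{X}}s(x'\gamma)\ge C_s\}$ for a finite constant $C_\theta$ and a constant $C_s>0$, and let $\mathrm{int}(\Theta^c)$ denote its interior. Assumption 1: for $a=0$ or $a=-\infty$, $s:(a,\infty)\to(0,\infty)$ is three times differentiable, strictly increasing and convex, with $\lim_{t\to a}s(t)=0$ and $\lim_{t\to\infty}s(t)=\infty$. Assumption 2: $x\mapsto\sigma(x)^2$ is bounded away from $0$ uniformly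 on $\mathcal{X}$. Assumption 3: (i) $E[Y^4]<\infty$ and $E\|X\|^4<\infty$; (ii) for all $\gamma\in\Theta_\gamma$, $E[\|X\|^4s_2(X'\gamma)^2]<\infty$, $E[\|X\|^6s_3(X'\gamma)^2]<\infty$ and $E[\|X\|^6s_1(X'\gamma)^2s_2(X'\gamma)^2]<\infty$. Assumption 4: for all $\gamma\in\Theta_\gamma$, $E[XX'/s(X'\gamma)]$ is nonsingular. *)

(* Defs.v *)
From HB Require Import structures.
From mathcomp Require Import all_boot all_order all_algebra.
From mathcomp Require Import all_classical all_reals all_analysis.
Set Implicit Arguments. Unset Strict Implicit. Unset Printing Implicit Defensive.
Import Order.TTheory GRing.Theory Num.Theory.
Import numFieldNormedType.Exports.
Local Open Scope classical_set_scope.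
Local Open Scope ring_scope.

Section defs.
Context {R : realType}.

Definition dotv k (x b : 'rV[R]_k) : R := \sum_(i < k) x ord0 i * b ord0 i.

Definition sqnorm k (x : 'rV[R]_k) : R := \sum_(i < k) x ord0 i ^+ 2.

Definition theta_norm k (th : 'rV[R]_k * 'rV[R]_k) : R :=
  Num.sqrt (sqnorm th.1 + sqnorm th.2).

Definition borel_rV k : set (set 'rV[R]_k) := <<s open >>.

Context {d : measure_display} {T : measurableType d} (P : probability T R).

Definition rvec k (X : 'I_k -> T -> R) (w : T) : 'rV[R]_k := \row_i X i w.

Definition is_cond_exp k (Z : T -> R) (X : T -> 'rV[R]_k) (m : 'rV[R]_k -> R) :=
  [/\ (forall A : set R, measurable A -> borel_rV (m @^-1` A)),
      P.-integrable setT (EFin \o Z),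
      P.-integrable setT (EFin \o (m \o X)) &
      forall B, borel_rV B ->
        (\int[P]_(w in X @^-1` B) (Z w)%:E = \int[P]_(w in X @^-1` B) (m (X w))%:E)%E].

Definition supp_rv k (X : T -> 'rV[R]_k) : set 'rV[R]_k :=
  [set x | forall U, open U -> U x -> (0 < P (X @^-1` U))%E].

End defs.

(* Main.v *)
Require Import Defs.
From HB Require Import structures.
From mathcomp Require Import finmap.
From mathcomp Require Import all_boot all_order all_algebra.
From mathcomp Require Import all_classical all_reals all_analysis.
From mathcomp Require Import measurable_realfun.
From mathcomp Require Import ring lra.
Import Order.TTheory GRing.Theory Num.Theory.
Import numFieldNormedType.Exports.
Local Open Scope classical_set_scope.
Local Open Scope ring_scope.

(** Write [S = s(X'gamma)], [S0 = s(X'gamma0)] and [U = X'beta - X'beta0].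
    Conditioning on [X] gives [E[(Y - X'beta)^2 | X] = S0^2 + U^2], and
    [(S0^2 + U^2) / S + S = 2 S0 + ((S - S0)^2 + U^2) / S], whence
    [Q(theta) = E[S0] + E[((S - S0)^2 + U^2) / (2 S)]].  The first term is finite
    and is [Q(theta0)]; the second is nonnegative and vanishes only if [S = S0]
    and [U = 0] almost surely.  As [s] is strictly increasing, [X'(gamma - gamma0)]
    and [X'(beta - beta0)] are then almost surely zero, and the nonsingularity of
    [E[XX'/s(X'gamma0)]] gives [theta = theta0]. *)

(** * Preliminaries: measurability of inversion, integrability of bounded multiples *)

Lemma measurable_invr (R : realType) :
  measurable_fun setT (GRing.inv : R -> R).
Proof.
have mneq0 : measurable_fun setT (fun x : R => x == 0).
  by apply: measurable_fun_eqr; [exact: measurable_id | exact: measurable_cst].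
(* Inversion is continuous off [0], and the convention [0^-1 = 0] settles the remaining point, so it
   is measurable piecewise. *)
have -> : (GRing.inv : R -> R) = fun x => if x == 0 then 0 else x^-1.
  by apply/funext => x; case: eqP => // ->; rewrite invr0.
apply: measurable_fun_if => //.
have -> : setT `&` (fun x : R => x == 0) @^-1` [set false] = [set x | x != 0].
  apply/seteqP; split => x /=; first by move=> [_ ->].
  by move/negbTE.
apply: open_continuous_measurable_fun.
  exact: open_neq.
by move=> x; rewrite inE /= => x0; exact: inv_continuous.
Qed.

Lemma integrable_mul_bounded {d} {T : measurableType d} {R : realType}
  (P : probability T R) (F h : T -> R) (K : R) :
  P.-integrable setT (EFin \o F) -> measurable_fun setT h ->
  (forall w, `|h w| <= K) -> P.-integrable setT (fun w => (F w * h w)%:E).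
Proof.
move=> intF mh hK; apply: (@integrableMl _ _ _ P setT measurableT (EFin \o F) h) => //.
exists K; split; first exact: num_real.
by move=> M KM w _ /=; exact: le_trans (hK w) (ltW KM).
Qed.

(** * Orthogonality of a conditionally centred variable to bounded functions of [W] *)

Section pull_out.
Local Open Scope ereal_scope.
Context {d d' : measure_display} {T : measurableType d} {T' : measurableType d'}
  {R : realType} {P : probability T R}.
Context {F : T -> R} {W : T -> T'}.
Hypotheses (mW : measurable_fun setT W)
  (intF : P.-integrable setT (EFin \o F))
  (F0 : forall A, measurable A -> \int[P]_(w in W @^-1` A) (F w)%:E = 0).

Import HBNNSimple.

(** Hypothesis [F0] says that [F] has conditional mean zero given [W]. The integral splits over the
    finitely many level sets of [f]; the part [g y] is [y] times [F] restricted to the event that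
    [W] lies in one level set, where [F0] applies. *)
Lemma integral_pull_out_nnsfun (f : {nnsfun T' >-> R}) :
  \int[P]_w (F w * f (W w))%:E = 0.
Proof.
pose g (y : R) w := y%:E * ((EFin \o F) \_ (W @^-1` (f @^-1` [set y]))) w.
have mfW y : measurable (W @^-1` (f @^-1` [set y])).
  by rewrite -[X in measurable X]setTI; exact: mW.
have intFy y : P.-integrable setT ((EFin \o F) \_ (W @^-1` (f @^-1` [set y]))).
  by apply/(integrable_mkcond _ (mfW y)); exact: (integrableS measurableT (mfW y) (@subsetT _ _) intF).
transitivity (\int[P]_w (\sum_(y <- fset_set (range f)) g y w)%R).
  apply: eq_integral => w _.
  rewrite fimfunE fsbig_finite//= mulr_sumr -sumEFin.
  apply: eq_bigr => y _; rewrite /g patchE indicE /=.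
  have -> : (W w \in f @^-1` [set y]) = (w \in W @^-1` (f @^-1` [set y])) by [].
  case: ifPn => /= _; last by rewrite !mulr0 mule0.
  by rewrite mulr1 mulrC EFinM.
rewrite integral_sum//; last by move=> y; exact: integrableZl.
rewrite big1// => y _; rewrite /g integralZl// -integral_mkcond.
by rewrite F0 ?mule0// -[X in measurable X]setTI; exact: measurable_funP.
Qed.

(** Simple functions increase to [g], and the products with [F] are dominated by [K * |F|], so
    dominated convergence carries the value zero to the limit. *)
Lemma ge0_integral_pull_out (g : T' -> R) (K : R) :
  measurable_fun setT g -> (forall x, (0 <= g x <= K)%R) ->
  \int[P]_w (F w * g (W w))%:E = 0.
Proof.
move=> mg gK.
have mEg : measurable_fun setT (EFin \o g) by exact/measurable_EFinP.
have mF : measurable_fun setT F by apply/measurable_EFinP; exact: measurable_int intF.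
pose f_ n w := (F w * nnsfun_approx measurableT mEg n (W w))%:E.
have [] := @dominated_convergence _ _ _ P setT measurableT f_
   (fun w => (F w * g (W w))%:E) (fun w => K%:E * `|F w|%:E).
- move=> n; apply/measurable_EFinP; apply: measurable_funM => //.
  exact: measurableT_comp.
- apply/measurable_EFinP; apply: measurable_funM => //.
  exact: measurableT_comp.
- apply: aeW => w _; rewrite /f_.
  under eq_fun do rewrite EFinM.
  rewrite EFinM; apply: cvgeZl => //.
  apply: (@cvg_nnsfun_approx _ _ _ _ measurableT (EFin \o g) mEg _ (W w)) => //.
  by move=> x _; rewrite lee_fin; case/andP: (gK x).
- apply: integrableZl => //.
  exact: (@integrable_norm _ _ _ P setT F).
- apply: aeW => w n _; rewrite /f_ -EFinM /= lee_fin normrM mulrC.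
  rewrite ler_wpM2r// ger0_norm ?fun_ge0// nnsfun_approxE.
  apply: (@le_trans _ _ (g (W w))); last by case/andP: (gK (W w)).
  rewrite -lee_fin; apply: (@le_approx _ _ _ setT (EFin \o g)) => //.
  by move=> x _; rewrite lee_fin; case/andP: (gK x).
move=> _ _ /cvg_lim <-//.
under eq_fun do rewrite /= integral_pull_out_nnsfun.
exact: lim_cst.
Qed.

(** The shifted function [g + K] takes values between [0] and [K + K]; the shift itself contributes
    [K] times the integral of [F], which is zero by [F0] on the whole space. *)
Lemma integral_pull_out (g : T' -> R) (K : R) :
  measurable_fun setT g -> (forall x, (`|g x| <= K)%R) ->
  \int[P]_w (F w * g (W w))%:E = 0.
Proof.
move=> mg gK.
have intFK : P.-integrable setT (fun w => K%:E * (EFin \o F) w).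
  exact: integrableZl.
have K0 : \int[P]_w (F w * (g (W w) + K))%:E = 0.
  apply: (@ge0_integral_pull_out (fun x => g x + K)%R (K + K)).
    by apply: measurable_funD => //; exact: measurable_cst.
  by move=> x; move: (gK x); rewrite ler_norml; lra.
have ifK : P.-integrable setT (fun w => (F w * (g (W w) + K))%:E).
  apply: (@integrable_mul_bounded _ _ _ _ _ (fun w => (g (W w) + K)%R) (K + K)) => //.
    apply: measurable_funD => //; exact: measurableT_comp.
  by move=> w; move: (gK (W w)); rewrite !ler_norml; lra.
transitivity (\int[P]_w ((F w * (g (W w) + K))%:E - K%:E * (F w)%:E)).
  by apply: eq_integral => w _; rewrite -EFinM -EFinB; congr EFin; ring.
rewrite integralB// K0 integralZl//.
by have := F0 setT measurableT; rewrite preimage_setT => ->; rewrite mule0 sube0.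
Qed.

End pull_out.

(** * Expected loss as the mean of [S0] plus a nonnegative excess *)

Section loss_decomposition.
Context {d : measure_display} {T : measurableType d} {R : realType}
  (P : probability T R).
Variables e V U S S0 : T -> R.
Hypotheses (mU : measurable_fun setT U) (mS : measurable_fun setT S)
  (mS0 : measurable_fun setT S0)
  (S_gt0 : forall w, 0 < S w) (S0_gt0 : forall w, 0 < S0 w)
  (int_e : P.-integrable setT (EFin \o e))
  (int_e2 : P.-integrable setT (fun w => (e w ^+ 2)%:E))
  (int_V : P.-integrable setT (EFin \o V))
  (VS0 : {ae P, forall w, V w = S0 w ^+ 2}).

Let W w := (U w, S w).

Hypotheses
  (e_mean0 : forall A : set (R * R), measurable A ->
     (\int[P]_(w in W @^-1` A) (e w)%:E = 0)%E)
  (e2_mean : forall A : set (R * R), measurable A ->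
     (\int[P]_(w in W @^-1` A) (e w ^+ 2 - V w)%:E = 0)%E).

(** [e ^+ 2 / S] need not be integrable, so the conditional moments of [e] are
    used on the sets [D m], where [U], [S] and [S^-1] are bounded; monotone
    convergence then gives the identity, both sides being possibly infinite. *)
Let B (m : nat) := [set p : R * R |
  [&& `|p.1| <= m.+1%:R, m.+1%:R^-1 <= p.2 & p.2 <= m.+1%:R]].
Let D m := W @^-1` B m.
Let q w := 2^-1 * (((e w - U w) / S w) ^+ 2 + 1) * S w.
Let qbar w := 2^-1 * ((S0 w ^+ 2 + U w ^+ 2) / S w + S w).

Let mW : measurable_fun setT W.
Proof. by apply/measurable_fun_pairP. Qed.

Let mB m : measurable (B m).
Proof.
rewrite -[B m]setTI.
have : measurable_fun setT (fun p : R * R => [&& `|p.1| <= m.+1%:R,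
    m.+1%:R^-1 <= p.2 & p.2 <= m.+1%:R]).
  apply: measurable_and; last apply: measurable_and;
    apply: measurable_fun_ler => //.
  by apply: measurableT_comp.
by move/(_ measurableT [set true]); apply.
Qed.

Let mD m : measurable (D m).
Proof. by rewrite -[D m]setTI; exact: mW. Qed.

Let nd_D : nondecreasing_seq D.
Proof.
move=> m k mk; apply/subsetPset => w; rewrite /D /B /= => /and3P[U1 S1 S2].
have MK : m.+1%:R <= k.+1%:R :> R by rewrite ler_nat.
rewrite (le_trans U1 MK) (le_trans S2 MK) andbT /=.
by apply: le_trans S1; rewrite lef_pV2 ?posrE.
Qed.

Let bigcup_D : \bigcup_m D m = setT.
Proof.
apply/seteqP; split => // w _.
(* [m.+1] exceeds the sum of the three nonnegative quantities, hence each of [|U w|], [S w] and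
   [(S w)^-1]. *)
exists (Num.truncn (`|U w| + S w + (S w)^-1)) => //.
rewrite /D /B /=; set m := Num.truncn _.
have Sw := S_gt0 w; have Siw : 0 < (S w)^-1 by rewrite invr_gt0.
have := truncnS_gt (`|U w| + S w + (S w)^-1); rewrite -/m => mb.
have U0 := normr_ge0 (U w).
apply/and3P; split; [lra| |lra].
by rewrite -[leRHS]invrK lef_pV2 ?posrE ?invr_gt0//; lra.
Qed.

Let me : measurable_fun setT e.
Proof. by apply/measurable_EFinP; exact: measurable_int int_e. Qed.

Let mSi : measurable_fun setT (fun w => (S w)^-1).
Proof. by apply: measurableT_comp => //; exact: measurable_invr. Qed.

Let mq : measurable_fun setT (EFin \o q).
Proof.
apply/measurable_EFinP; rewrite /q; apply: measurable_funM => //.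
apply: measurable_funM => //; apply: measurable_funD => //.
apply: measurable_funX; apply: measurable_funM => //.
exact: measurable_funB.
Qed.

Let mqbar : measurable_fun setT (EFin \o qbar).
Proof.
apply/measurable_EFinP; rewrite /qbar; apply: measurable_funM => //.
apply: measurable_funD => //; apply: measurable_funM => //.
by apply: measurable_funD; apply: measurable_funX.
Qed.

Let mS_snd_inv : measurable_fun setT (fun p : R * R => p.2^-1).
Proof.
apply: (measurableT_comp (@measurable_invr R)); exact: measurable_snd.
Qed.

(** Expanding the square on [D m] gives [q = e * (- U / S) + (e ^+ 2 - V) / (2 * S) + (V / (2 * S) +
    (U ^+ 2 / S + S) / 2)]. The factors [g1], [g2], [g3] carry the indicator of [B m], hence are
    bounded functions of [W], and the first two terms integrate to zero by [integral_pull_out]. *)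
Let integral_q_D m : 
  (\int[P]_(w in D m) (q w)%:E = \int[P]_(w in D m) (qbar w)%:E)%E.
Proof.
pose M : R := m.+1%:R.
have M1 : 1 <= M by rewrite /M -[leLHS]/(1%:R) ler_nat.
pose g1 (p : R * R) := \1_(B m) p * (- p.1 / p.2).
pose g2 (p : R * R) := \1_(B m) p * (2^-1 / p.2).
pose g3 (p : R * R) := \1_(B m) p * (2^-1 * (p.1 ^+ 2 / p.2 + p.2)).
have m1 : measurable_fun setT g1.
  apply: measurable_funM; first exact: measurable_indic.
  by apply: measurable_funM => //; apply: measurableT_comp.
have m2 : measurable_fun setT g2.
  apply: measurable_funM; first exact: measurable_indic.
  by apply: measurable_funM.
have m3 : measurable_fun setT g3.
  apply: measurable_funM; first exact: measurable_indic.
  apply: measurable_funM => //; apply: measurable_funD => //.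
  by apply: measurable_funM => //; apply: measurable_funX.
have inB p : p \in B m -> [/\ `|p.1| <= M, 0 < p.2^-1, p.2^-1 <= M & p.2 <= M].
  rewrite inE /B /= => /and3P[? h ?]; split => //.
    by rewrite invr_gt0; apply: lt_le_trans h; rewrite invr_gt0.
  rewrite -[leRHS]invrK lef_pV2 ?posrE ?invr_gt0//.
  by apply: lt_le_trans h; rewrite invr_gt0.
have b1 p : `|g1 p| <= M * M.
  rewrite /g1 indicE; case: (boolP (p \in B m)) => [/inB[? ? ? ?]|_].
    rewrite mul1r normrM normrN ler_pM// gtr0_norm//.
  by rewrite mul0r normr0; nra.
have b2 p : `|g2 p| <= M.
  rewrite /g2 indicE; case: (boolP (p \in B m)) => [/inB[? ? ? ?]|_].
    by rewrite mul1r ger0_norm; nra.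
  by rewrite mul0r normr0; nra.
have b3 p : `|g3 p| <= M * M * M + M.
  rewrite /g3 indicE; case: (boolP (p \in B m)) => [/inB[h1 h2 h3 h4]|_].
    have p20 : 0 < p.2 by rewrite -invr_gt0.
    have h5 : p.1 ^+ 2 / p.2 <= M * M * M.
      apply: ler_pM; rewrite ?sqr_ge0 ?(ltW h2)//.
      by rewrite -real_normK ?num_real// expr2 ler_pM.
    have h6 : 0 <= p.1 ^+ 2 / p.2 by rewrite mulr_ge0 ?sqr_ge0// ltW.
    by rewrite mul1r ger0_norm; nra.
  by rewrite mul0r normr0; nra.
have int_f1 : P.-integrable setT (fun w => (e w * g1 (W w))%:E).
  apply: (@integrable_mul_bounded _ _ _ _ _ _ (M * M)) => //.
  exact: measurableT_comp.
have int_e2V : P.-integrable setT (fun w => (e w ^+ 2 - V w)%:E).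
  by under eq_fun do rewrite EFinB; exact: integrableB.
have int_f2 : P.-integrable setT (fun w => ((e w ^+ 2 - V w) * g2 (W w))%:E).
  apply: (@integrable_mul_bounded _ _ _ _ _ _ M) => //.
  exact: measurableT_comp.
have int_f3 : P.-integrable setT (fun w => (V w * g2 (W w) + g3 (W w))%:E).
  under eq_fun do rewrite EFinD; apply: integrableD => //.
    apply: (@integrable_mul_bounded _ _ _ _ _ _ M) => //.
    exact: measurableT_comp.
  (* A bounded function is integrable under a probability: it is the constant [1] times a bounded
     factor. *)
  rewrite (_ : (fun _ => _) = fun w => (1 * g3 (W w))%:E); last first.
    by apply/funext => w; rewrite mul1r.
  apply: (@integrable_mul_bounded _ _ _ _ (cst 1) _ (M * M * M + M)) => //.
    exact: finite_measure_integrable_cst.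
  exact: measurableT_comp.
rewrite [LHS]integral_mkcond [RHS]integral_mkcond.
transitivity (\int[P]_w (((e w * g1 (W w))%:E + ((e w ^+ 2 - V w) * g2 (W w))%:E)
    + (V w * g2 (W w) + g3 (W w))%:E))%E.
  apply: eq_integral => w _; rewrite patchE /g1 /g2 /g3 indicE.
  have -> : (W w \in B m) = (w \in D m) by [].
  case: ifPn => _; last by rewrite /= !(mul0r, mulr0, addr0).
  rewrite /=; congr EFin; rewrite /q.
  by have Sneq0 := lt0r_neq0 (S_gt0 w); field.
rewrite integralD//; last exact: integrableD.
rewrite integralD// (integral_pull_out mW int_e e_mean0 _ _ m1 b1).
rewrite (integral_pull_out mW int_e2V e2_mean _ _ m2 b2) add0e add0e.
(* With the centred terms gone, what remains is [qbar] on [D m] once [V] is replaced by [S0 ^+ 2],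
   an equality that holds only almost surely. *)
apply: ae_eq_integral => //.
- exact: measurable_int int_f3.
- by apply/(measurable_restrictT _ (mD m)); exact: measurable_funTS.
- move: VS0; apply: filterS => w VS _.
  rewrite patchE /g2 /g3 indicE.
  have -> : (W w \in B m) = (w \in D m) by [].
  case: ifPn => _; last by rewrite !(mul0r, mulr0, addr0).
  by rewrite /= VS /qbar; congr EFin; ring.
Qed.

Lemma integral_loss_decomposition :
  (\int[P]_w (2^-1 * (((e w - U w) / S w) ^+ 2 + 1) * S w)%:E =
   \int[P]_w (S0 w)%:E +
   \int[P]_w (((S w - S0 w) ^+ 2 + U w ^+ 2) / (2 * S w))%:E)%E.
Proof.
have q0 w : 0 <= q w.
  by rewrite /q !mulr_ge0 ?invr_ge0 ?addr_ge0 ?sqr_ge0 ?ltW.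
have qbar0 w : 0 <= qbar w.
  apply: mulr_ge0 => //; apply: addr_ge0; last exact: ltW.
  by apply: divr_ge0; [rewrite addr_ge0// sqr_ge0 | exact: ltW].
transitivity (\int[P]_w (qbar w)%:E)%E.
  rewrite -bigcup_D.
  have Dq : (\int[P]_(w in D m) (q w)%:E)%E @[m --> \oo] -->
      (\int[P]_(w in \bigcup_m D m) (q w)%:E)%E.
    apply: ge0_nondecreasing_set_cvg_integral => //.
      by move=> i; exact: measurable_funTS.
    by move=> i x _; rewrite lee_fin.
  have Dqbar : (\int[P]_(w in D m) (qbar w)%:E)%E @[m --> \oo] -->
      (\int[P]_(w in \bigcup_m D m) (qbar w)%:E)%E.
    apply: ge0_nondecreasing_set_cvg_integral => //.
      by move=> i; exact: measurable_funTS.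
    by move=> i x _; rewrite lee_fin.
  move/cvg_lim : Dq => <-//; move/cvg_lim : Dqbar => <-//.
  by congr (lim _); under eq_fun do rewrite integral_q_D.
(* Completing the square gives [qbar = S0 + ((S - S0) ^+ 2 + U ^+ 2) / (2 * S)]; both summands are
   nonnegative, so the integral splits even when infinite. *)
rewrite -ge0_integralD//.
- apply: eq_integral => w _; rewrite -EFinD /qbar; congr EFin.
  by have Sneq0 := lt0r_neq0 (S_gt0 w); field.
- by move=> w _; rewrite lee_fin ltW.
- exact/measurable_EFinP.
- move=> w _; rewrite lee_fin; apply: divr_ge0.
    by rewrite addr_ge0// sqr_ge0.
  by rewrite mulr_ge0// ltW.
apply/measurable_EFinP; apply: measurable_funM.
  by apply: measurable_funD; apply: measurable_funX => //; apply: measurable_funB.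
apply: (measurableT_comp (@measurable_invr R)).
exact: measurable_funM.
Qed.

End loss_decomposition.

(** * Linear forms: measurability, and nondegeneracy through the Gram matrix *)

Lemma measurable_dotv {d} {T : measurableType d} {R : realType} k
  (Z : T -> 'rV[R]_k) (b : 'rV[R]_k) :
  (forall i, measurable_fun setT (fun w => Z w ord0 i)) ->
  measurable_fun setT (fun w => dotv (Z w) b).
Proof.
move=> mZ; apply/measurable_EFinP; rewrite /comp /dotv.
under eq_fun do rewrite -sumEFin.
apply: emeasurable_sum => i.
apply/measurable_EFinP.
by apply: measurable_funM.
Qed.

(** Coordinates are continuous and open intervals generate the Borel sets of [R]. This puts
    preimages under functions of linear forms into [borel_rV], the sets on which [is_cond_exp] can
    be tested. *)
Lemma measurable_borel_dotv {R : realType} k (b : 'rV[R]_k.+1) :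
  measurable_fun setT
    (fun x : g_sigma_algebraType (@open 'rV[R]_k.+1) => dotv x b).
Proof.
apply: measurable_dotv => i; apply: (measurability (@RGenOpens.G R)).
  exact: RGenOpens.measurableE.
move=> _ [A oA <-]; rewrite setTI; apply: sub_sigma_algebra.
have /continuousP cc := @coord_continuous R 1 k.+1 ord0 i.
by case: oA => x [y ->]; exact: cc (interval_open _ _).
Qed.

Lemma prob1_ae {d} {T : measurableType d} {R : realType} (P : probability T R)
  (A : set T) : measurable A -> P A = 1%E -> {ae P, forall w, A w}.
Proof.
move=> mA PA; exists (~` A); split => //; first exact: measurableC.
by rewrite probability_setC// PA subee.
Qed.

Lemma dotvBr {R : realType} k (x b c : 'rV[R]_k) :
  dotv x (b - c) = dotv x b - dotv x c.
Proof.
by rewrite /dotv -sumrB; apply: eq_bigr => i _; rewrite !mxE mulrBr.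
Qed.

(** Row [i] of the matrix applied to [v] is the mean of [X i * X'v / S], by linearity over
    integrable entries, and this vanishes with [X'v]; invertibility then forces [v = 0]. *)
Lemma gram_ae_orthogonal_eq0 {d} {T : measurableType d} {R : realType}
  (P : probability T R) k (X : 'I_k -> T -> R) (S : T -> R) (v : 'rV[R]_k) :
  (forall i j, P.-integrable setT (fun w => (X i w * X j w / S w)%:E)) ->
  (\matrix_(i, j) fine 'E_P[fun w => X i w * X j w / S w]) \in unitmx ->
  {ae P, forall w, dotv (rvec X w) v = 0} -> v = 0.
Proof.
move=> intX; set M := (X in X \in unitmx) => uM Xv0.
suff Mv : M *m v^T = 0.
  by rewrite -[v]trmxK -[v^T](mulKmx uM) Mv mulmx0 trmx0.
apply/matrixP => i j; rewrite !mxE.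
have finE l : (\int[P]_w (X i w * X l w / S w)%:E)%E \is a fin_num.
  by apply: integrable_fin_num.
apply: EFin_inj; rewrite -sumEFin.
transitivity (\sum_(l < k) \int[P]_w ((v ord0 l)%:E * (X i w * X l w / S w)%:E))%E.
  apply: eq_bigr => l _; rewrite !mxE integralZl// unlock EFinM fineK// muleC.
  by rewrite (ord1 j).
rewrite -integral_sum//; last by move=> l; apply: integrableZl.
rewrite -[RHS](integral0 P setT); apply: ae_eq_integral => //.
  apply: emeasurable_sum => l; apply: (@measurable_int _ _ _ P).
  exact: integrableZl.
move: Xv0; apply: filterS => w Xv0 _ /=.
rewrite sumEFin; congr EFin.
transitivity (X i w / S w * dotv (rvec X w) v); last by rewrite Xv0 mulr0.
by rewrite /dotv mulr_sumr; apply: eq_bigr => l _; rewrite mxE; ring.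
Qed.

(** * A positive measurable extension of the scale function *)

Section scale.
Context {R : realType} (s : R -> R) (a : \bar R).

(** The values of [s] off its domain are arbitrary, possibly making [s] non-measurable. *)
Definition scale_ext (t : R) := if (a < t%:E)%E then s t else 1.

Lemma scale_ext_gt0 : (forall t, (a < t%:E)%E -> 0 < s t) ->
  forall t, 0 < scale_ext t.
Proof. by move=> s0 t; rewrite /scale_ext; case: ifPn => // /s0. Qed.

Lemma measurable_scale_ext : (forall t, (a < t%:E)%E -> derivable s t 1) ->
  measurable_fun setT scale_ext.
Proof.
move=> ds.
have mE : measurable [set t : R | (a < t%:E)%E].
  by apply: open_measurable; exact: open_ereal_gt.
have E1 : setT `&` (fun t : R => (a < t%:E)%E) @^-1` [set true]
    = [set t : R | (a < t%:E)%E].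
  by rewrite setTI.
apply: measurable_fun_if => //.
- apply: (measurable_fun_bool true).
  by rewrite E1.
- rewrite E1; apply: open_continuous_measurable_fun; first exact: open_ereal_gt.
  move=> t; rewrite inE /= => ta.
  exact/differentiable_continuous/derivable1_diffP/ds.
Qed.

End scale.

(** * Minimality and identification of [(beta0, gamma0)] *)

Theorem theorem1 (d : measure_display) (T : measurableType d) (R : realType)
  (P : probability T R) (n : nat)
  (Y : T -> R) (X : 'I_n.+1 -> T -> R)
  (mu sigma2 : 'rV[R]_n.+1 -> R)
  (s : R -> R) (a : \bar R) (C_theta C_s : R)
  (beta0 gamma0 : 'rV[R]_n.+1) :
  (* random variables *)
  measurable_fun setT Y ->
  (forall i, measurable_fun setT (X i)) ->
  (forall w, X ord0 w = 1) ->
  (* mu(X) = E[Y|X], sigma(X)^2 = E[(Y - mu(X))^2 | X] *)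
  is_cond_exp P Y (rvec X) mu ->
  is_cond_exp P (fun w => (Y w - mu (rvec X w)) ^+ 2) (rvec X) sigma2 ->
  (* Assumption 1 *)
  (a = 0%E \/ a = -oo%E) ->
  (forall t, (a < t%:E)%E -> 0 < s t) ->
  (forall t, (a < t%:E)%E ->
     [/\ derivable s t 1, derivable (derive1 s) t 1 & derivable (derive1n 2 s) t 1]) ->
  (forall x y, (a < x%:E)%E -> (a < y%:E)%E -> x < y -> s x < s y) ->
  (forall x y l, (a < x%:E)%E -> (a < y%:E)%E -> 0 <= l <= 1 ->
     s (l * x + (1 - l) * y) <= l * s x + (1 - l) * s y) ->
  (a = 0%E -> s t @[t --> 0^'+] --> 0) ->
  (a = -oo%E -> s t @[t --> -oo] --> 0) ->
  s t @[t --> +oo] --> +oo ->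
  (* Assumption 2 *)
  (exists c, 0 < c /\ forall x, supp_rv P (rvec X) x -> c <= sigma2 x) ->
  (* Assumption 3 *)
  P.-integrable setT (fun w => (Y w ^+ 4)%:E) ->
  P.-integrable setT (fun w => (sqnorm (rvec X w) ^+ 2)%:E) ->
  (forall gamma : 'rV[R]_n.+1,
     P [set w | (a < (dotv (rvec X w) gamma)%:E)%E /\ 0 < s (dotv (rvec X w) gamma)] = 1%E ->
     [/\ P.-integrable setT (fun w =>
            (sqnorm (rvec X w) ^+ 2 * (derive1n 2 s) (dotv (rvec X w) gamma) ^+ 2)%:E),
         P.-integrable setT (fun w =>
            (sqnorm (rvec X w) ^+ 3 * (derive1n 3 s) (dotv (rvec X w) gamma) ^+ 2)%:E) &
         P.-integrable setT (fun w =>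
            (sqnorm (rvec X w) ^+ 3 * (derive1n 1 s) (dotv (rvec X w) gamma) ^+ 2
               * (derive1n 2 s) (dotv (rvec X w) gamma) ^+ 2)%:E)]) ->
  (* Assumption 4 *)
  (forall gamma : 'rV[R]_n.+1,
     P [set w | (a < (dotv (rvec X w) gamma)%:E)%E /\ 0 < s (dotv (rvec X w) gamma)] = 1%E ->
     (forall i j, P.-integrable setT (fun w =>
         (X i w * X j w / s (dotv (rvec X w) gamma))%:E)) /\
     (\matrix_(i, j) fine 'E_P[fun w => X i w * X j w / s (dotv (rvec X w) gamma)])
       \in unitmx) ->
  (* theta0 in the interior of Theta^c *)
  0 < C_s ->
  (interior [set th : 'rV[R]_n.+1 * 'rV[R]_n.+1 |
        P [set w | (a < (dotv (rvec X w) th.2)%:E)%E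
                   /\ 0 < s (dotv (rvec X w) th.2)] = 1%E
        /\ theta_norm th <= C_theta
        /\ forall x, supp_rv P (rvec X) x ->
             (a < (dotv x th.2)%:E)%E /\ C_s <= s (dotv x th.2)] (beta0, gamma0)) ->
  (* correct specification *)
  {ae P, forall w, mu (rvec X w) = dotv (rvec X w) beta0
                   /\ sigma2 (rvec X w) = s (dotv (rvec X w) gamma0) ^+ 2} ->
  (* conclusion: theta0 is the unique minimizer of Q over Theta *)
  let Theta := [set th : 'rV[R]_n.+1 * 'rV[R]_n.+1 |
        P [set w | (a < (dotv (rvec X w) th.2)%:E)%E
                   /\ 0 < s (dotv (rvec X w) th.2)] = 1%E] in
  let Q := fun th : 'rV[R]_n.+1 * 'rV[R]_n.+1 =>
        (\int[P]_w ((2^-1 * (((Y w - dotv (rvec X w) th.1) / s (dotv (rvec X w) th.2)) ^+ 2 + 1)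
                     * s (dotv (rvec X w) th.2))%:E))%E in
  Theta (beta0, gamma0) /\
  (forall th, Theta th -> (Q (beta0, gamma0) <= Q th)%E) /\
  (forall th, Theta th -> Q th = Q (beta0, gamma0) -> th = (beta0, gamma0)).
Proof.
move=> mY mX X1 [mmu intY intmu ceY] [msig inte2 intsig cee2] _ s_gt0 ds smono _ _ _ _ _
  _ _ _ A4 _ /interior_subset [Th0 _] spec /=.
set Theta := fun g : 'rV[R]_n.+1 => P [set w | (a < (dotv (rvec X w) g)%:E)%E
                   /\ 0 < s (dotv (rvec X w) g)] = 1%E in Th0 A4 *.
(* [st] is positive and measurable everywhere, as the loss decomposition requires; [stE] below
   returns to [s] almost surely for each admissible [g]. *)
pose st := scale_ext s a.
have st_gt0 := scale_ext_gt0 s a s_gt0.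
have mst : measurable_fun setT st.
  by apply: measurable_scale_ext => t /ds[].
have mXg g : measurable_fun setT (fun w => dotv (rvec X w) g).
  apply: measurable_dotv => i.
  by rewrite (_ : (fun _ => _) = X i)//; apply/funext => w; rewrite mxE.
(* Since [s] is positive on its domain, the event defining [Theta] is the preimage of an open
   half-line, hence measurable as [prob1_ae] demands. *)
have in_dom g : Theta g -> {ae P, forall w, (a < (dotv (rvec X w) g)%:E)%E}.
  rewrite /Theta (_ : [set w | _] = [set w | (a < (dotv (rvec X w) g)%:E)%E]).
    apply: prob1_ae; rewrite -[X in measurable X]setTI.
    apply: (mXg g measurableT [set t : R | (a < t%:E)%E]).
    by apply: open_measurable; exact: open_ereal_gt.
  by apply/seteqP; split => w /= => [[]//|wa]; split => //; exact: s_gt0.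
have stE g : Theta g ->
    {ae P, forall w, st (dotv (rvec X w) g) = s (dotv (rvec X w) g)}.
  by move/in_dom; apply: filterS => w wa; rewrite /st /scale_ext wa.
(* The (0, 0) entry of [XX'/s(X'g)] is [1/s(X'g)], integrable by Assumption 4. *)
have msX g : Theta g -> measurable_fun setT (fun w => s (dotv (rvec X w) g)).
  move=> Tg; have [/(_ ord0 ord0) int1 _] := A4 _ Tg.
  rewrite (_ : (fun _ => _) = (fun w => (X ord0 w * X ord0 w / s (dotv (rvec X w) g))^-1)).
    apply: (measurableT_comp (@measurable_invr R)).
    by apply/measurable_EFinP; exact: measurable_int int1.
  by apply/funext => w; rewrite X1 !mul1r invrK.
(* Centring at [mu] rather than at [X'beta0] makes the conditional moments of [e] exactly those
   supplied by the two [is_cond_exp] hypotheses; [spec] enters later, almost surely. *)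
pose e w := Y w - mu (rvec X w).
have int_e : P.-integrable setT (EFin \o e).
  rewrite (_ : EFin \o e = (EFin \o Y) \- (EFin \o (mu \o rvec X)))%E.
    exact: integrableB.
  by apply/funext => w; rewrite /= EFinB.
pose V w := sigma2 (rvec X w).
pose S0 w := st (dotv (rvec X w) gamma0).
have VS0 : {ae P, forall w, V w = S0 w ^+ 2}.
  by move: spec (stE _ Th0); apply: filterS2 => w [_ +] sE; rewrite /S0 sE.
have mS0 : measurable_fun setT S0 by apply: measurableT_comp.
pose U b w := dotv (rvec X w) b - dotv (rvec X w) beta0.
pose S g w := st (dotv (rvec X w) g).
pose r b g w := ((S g w - S0 w) ^+ 2 + U b w ^+ 2) / (2 * S g w).
have mU b : measurable_fun setT (U b) by apply: measurable_funB.
have mS g : measurable_fun setT (S g) by apply: measurableT_comp.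
have QE b g : Theta g ->
  (\int[P]_w (2^-1 * (((Y w - dotv (rvec X w) b) / s (dotv (rvec X w) g)) ^+ 2 + 1)
                     * s (dotv (rvec X w) g))%:E
   = \int[P]_w (S0 w)%:E + \int[P]_w (r b g w)%:E)%E.
  (* The pair [(U b, S g)] is [L] composed with [X], and [L] is Borel, so events about the pair are
     events about [X]. *)
  move=> Tg; pose L (x : 'rV[R]_n.+1) := (dotv x b - dotv x beta0, st (dotv x g)).
  have bL (A : set (R * R)) : measurable A -> borel_rV (L @^-1` A).
    move=> mA; suff mL : measurable_fun setT
        (L : g_sigma_algebraType (@open 'rV[R]_n.+1) -> R * R).
      by rewrite -[L @^-1` A]setTI; exact: mL.
    apply/measurable_fun_pairP; split.
      by apply: measurable_funB; exact: measurable_borel_dotv.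
    apply: (measurableT_comp mst); exact: measurable_borel_dotv.
  have mW : measurable_fun setT (fun w => (U b w, S g w)).
    by apply/measurable_fun_pairP; split; [exact: mU | exact: mS].
  (* Serves both moment conditions: [Y] against [mu], and [e ^+ 2] against [sigma2]. *)
  have integral_sub_eq0 (Z m : T -> R) (A : set (R * R)) :
      P.-integrable setT (EFin \o Z) -> P.-integrable setT (EFin \o m) ->
      measurable A ->
      (forall B, borel_rV B -> (\int[P]_(w in rvec X @^-1` B) (Z w)%:E
                               = \int[P]_(w in rvec X @^-1` B) (m w)%:E)%E) ->
      (\int[P]_(w in (fun w => (U b w, S g w)) @^-1` A) (Z w - m w)%:E = 0)%E.
    move=> iZ im mA /(_ _ (bL _ mA)) Zm.
    have mWA : measurable ((fun w => (U b w, S g w)) @^-1` A).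
      by rewrite -[X in measurable X]setTI; exact: mW.
    under eq_integral do rewrite EFinB.
    have iZA := integrableS measurableT mWA (@subsetT _ _) iZ.
    have imA := integrableS measurableT mWA (@subsetT _ _) im.
    rewrite integralB//; rewrite /= in Zm *; rewrite [X in (X - _)%E]Zm subee//.
    exact: integrable_fin_num imA.
  rewrite -(integral_loss_decomposition P e V (U b) (S g) S0)//.
  (* Almost surely [mu] equals [X'beta0], so [e - U b] is [Y - X'b], and [st] agrees with [s] at
     [X'g]. *)
  - apply: ae_eq_integral => //.
    + apply/measurable_EFinP; apply: measurable_funM; last exact: msX.
      apply: measurable_funM => //; apply: measurable_funD => //.
      apply: measurable_funX; apply: measurable_funM; first exact: measurable_funB.
      by apply: (measurableT_comp (@measurable_invr R)); exact: msX.
    + apply/measurable_EFinP; apply: measurable_funM => //.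
      apply: measurable_funM => //; apply: measurable_funD => //.
      apply: measurable_funX; apply: measurable_funM; last first.
        exact: (measurableT_comp (@measurable_invr R)).
      apply: measurable_funB => //.
      by apply/measurable_EFinP; exact: measurable_int int_e.
    + move: spec (stE _ Tg); apply: filterS2 => w [muE _] sE _.
      by rewrite /e /U /S muE sE opprB addrA subrK.
  - by move=> w; exact: st_gt0.
  - by move=> w; exact: st_gt0.
  - by move=> A mA; apply: integral_sub_eq0.
  - by move=> A mA; apply: integral_sub_eq0.
have r_ge0 b g w : 0 <= r b g w.
  apply: divr_ge0; first by rewrite addr_ge0// sqr_ge0.
  by rewrite mulr_ge0// ltW// st_gt0.
have mr b g : measurable_fun setT (r b g).
  apply: measurable_funM.
    apply: measurable_funD; apply: measurable_funX => //.
    exact: measurable_funB.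
  by apply: (measurableT_comp (@measurable_invr R)); exact: measurable_funM.
have r0 : (\int[P]_w (r beta0 gamma0 w)%:E = 0)%E.
  apply: integral0_eq => w _.
  by rewrite /r /U /S /S0 !subrr expr0n /= addr0 mul0r.
(* From [0 <= (S0 - 1) ^+ 2] and [0 < S0] follows [S0 <= 1 + S0 ^+ 2], which is almost surely
   [1 + V] and integrable. *)
have S0_fin : (\int[P]_w (S0 w)%:E)%E \is a fin_num.
  rewrite ge0_fin_numE; last first.
    by apply: integral_ge0 => w _; rewrite lee_fin ltW// st_gt0.
  have int1 : P.-integrable setT (EFin \o cst 1).
    exact: finite_measure_integrable_cst.
  have int1V := integrable_abse (integrableD measurableT int1 intsig).
  apply: le_lt_trans (integrable_lty measurableT int1V).
  apply: ae_ge0_le_integral => //.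
  - by move=> w _; rewrite lee_fin ltW// st_gt0.
  - exact/measurable_EFinP.
  - by move=> w _; exact: abse_ge0.
  - exact: measurable_int int1V.
  move: VS0; apply: filterS => w VS _ /=.
  rewrite lee_fin; apply: le_trans (ler_norm _).
  by rewrite -/(V w) VS; have := sqr_ge0 (S0 w - 1); nra.
split; first exact: Th0.
split => [[b g] /= Tg|[b g] /= Tg]; rewrite !QE// r0 adde0.
  by rewrite leeDl// integral_ge0// => w _; rewrite lee_fin.
move=> Qeq.
(* [Q] is extended-real valued; the common term can be cancelled because it is finite. *)
have rbg0 : (\int[P]_w (r b g w)%:E = 0)%E.
  by rewrite -[LHS](addeK _ S0_fin) [X in (X - _)%E]addeC Qeq subee.
have rae : {ae P, forall w, r b g w = 0}.
  have /ae_eq_integral_abs : measurable_fun setT (EFin \o r b g) by exact/measurable_EFinP.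
  move=> /(_ P measurableT)[+ _].
  under eq_integral do rewrite gee0_abs ?lee_fin//.
  by move=> /(_ rbg0); apply: filterS => w /(_ Logic.I) /= [].
have US : {ae P, forall w, U b w = 0 /\ S g w = S0 w}.
  move: rae; apply: filterS => w /eqP.
  have S2_neq0 : (2 * S g w)^-1 != 0.
    by rewrite invr_eq0 mulf_neq0 ?lt0r_neq0// st_gt0.
  rewrite /r mulf_eq0 (negbTE S2_neq0) orbF paddr_eq0 ?sqr_ge0//.
  by rewrite !sqrf_eq0 subr_eq0 => /andP[/eqP ? /eqP ?].
have [intA uA] := A4 _ Th0.
(* Both components follow from the Gram matrix at [gamma0], once X'(b - beta0) and X'(g - gamma0)
   vanish almost surely; for the latter, strict monotonicity makes [s] injective on its domain. *)
congr pair; apply/eqP; rewrite -subr_eq0; apply/eqP;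
  apply: (gram_ae_orthogonal_eq0 _ _ _ _ _ intA uA).
- by move: US; apply: filterS => w [U0 _]; rewrite dotvBr.
- move: US (in_dom _ Tg) (in_dom _ Th0); apply: filterS3 => w [_ SS] ag a0.
  move: SS; rewrite /S /S0 /st /scale_ext ag a0 dotvBr => ss.
  apply/eqP; rewrite subr_eq0; apply/eqP.
  have [lt|lt|//] := ltgtP (dotv (rvec X w) g) (dotv (rvec X w) gamma0).
    by have := smono _ _ ag a0 lt; rewrite ss ltxx.
  by have := smono _ _ a0 ag lt; rewrite ss ltxx.
Qed.
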